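(* Let $N$ be a finite set, $b$ a positive integer, $g:2^N\to\mathbb{R}_{\ge0}$ monotone submodular with $g(\emptyset)=0$, and let $(x_S)_{S\subseteq N,|S|\le b}$ be nonnegative numbers with $\sum_Sx_S\le1$; set $y_j=\sum_{S\ni j}x_S$ for $j\in N$ and assume $\sum_{j\in N}y_j=b$. Let $\mathrm{OPT}=\sum_S g(S)x_S$. Consider the process with $T\ge b$ rounds in which, in each round independently, ball $j\in N$ arrives with probability $y_j/T$ (at most one ball per round) and no ball arrives with probability $1-b/T$, stopped as soon as $b$ arrivals (counted with multiplicity) have occurred or after round $T$. Let $\mathcal{S}$ be the set of distinct balls that arrived and $A$ the total number of arrivals before termination. Then $\mathbb{E}[g(\mathcal{S})\mid A=1]\ge\mathrm{OPT}/b$, and for every integer $\ell$ with $2\le\ell\le b$, $$\mathbb{E}[g(\mathcal{S})\mid A=\ell]\ge\mathrm{OPT}\cdot\big(1-e^{-1+(1-1/b)^\ell}\big).$$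
   Context: This is the per-task analysis of an online algorithm: $N$ is the neighbour set of a task with capacity $b$, $x_S$ are the optimal configuration-LP values $x^*_{i,S}$, $y_j$ the induced edge marginals, and the process describes which workers reach the task. Conditioning is on events of positive probability. *)

(* Defs.v *)
From HB Require Import structures.
From mathcomp Require Import all_boot all_order all_algebra.
From mathcomp Require Import reals.

Set Implicit Arguments.
Unset Strict Implicit.
Unset Printing Implicit Defensive.

Import Order.TTheory GRing.Theory Num.Theory.
Local Open Scope ring_scope.

Section SetFunctions.
Variables (R : realType) (N : finType).
Implicit Type g : {set N} -> R.

Definition monotone_set_fun g : Prop :=
  forall A B : {set N}, A \subset B -> g A <= g B.

Definition submodular g : Prop :=
  forall A B : {set N}, g (A :|: B) + g (A :&: B) <= g A + g B.

End SetFunctions.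

Section ConfigurationLP.
Variables (R : realType) (N : finType) (b : nat).
(* Only the values of x on sets of size at most b are ever used. *)
Implicit Type x : {set N} -> R.

Definition marginal x (j : N) : R :=
  \sum_(S : {set N} | (#|S| <= b)%N && (j \in S)) x S.

Definition opt (g : {set N} -> R) x : R :=
  \sum_(S : {set N} | (#|S| <= b)%N) g S * x S.

End ConfigurationLP.

Section FiniteProbability.
Variables (R : realType) (W : finType).

Definition prob (p : W -> R) (E : pred W) : R := \sum_(w | E w) p w.

(* Meaningful only if prob p E > 0. *)
Definition cond_expect (p : W -> R) (X : W -> R) (E : pred W) : R :=
  (\sum_(w | E w) p w * X w) / prob p E.

End FiniteProbability.

Section Process.
Variables (R : realType) (N : finType) (b T : nat).

(* An outcome lists what happens in each of the T rounds: Some j if ball j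
   arrives, None if no ball arrives. The outcome is drawn for all T rounds, and
   stopping is expressed by ignoring the rounds that are not [active]. *)
Definition outcome := {ffun 'I_T -> option N}.

Definition round_law (y : N -> R) (o : option N) : R :=
  if o is Some j then y j / T%:R else 1 - b%:R / T%:R.

Definition process_law (y : N -> R) (w : outcome) : R :=
  \prod_(t < T) round_law y (w t).

Definition active (w : outcome) (t : 'I_T) : bool :=
  (#|[set s : 'I_T | (s < t)%N && (w s != None)]| < b)%N.

Definition arrived (w : outcome) : {set N} :=
  [set j | [exists t : 'I_T, active w t && (w t == Some j)]].

Definition num_arrivals (w : outcome) : nat :=
  #|[set t : 'I_T | active w t && (w t != None)]|.

End Process.

(* Main.v *)
Require Import Defs.
From HB Require Import structures.
From mathcomp Require Import all_boot all_order all_algebra.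
From mathcomp Require Import reals sequences exp.
From mathcomp Require Import lra.

Set Implicit Arguments.
Unset Strict Implicit.
Unset Printing Implicit Defensive.

Import Order.TTheory GRing.Theory Num.Theory.
Local Open Scope ring_scope.

(* The balls that arrive, in order, form the sequence obtained from the word of
   rounds by erasing the empty rounds and truncating to length b. Conditioned
   on its length being l, this sequence consists of l independent draws with
   law y_j / b. By submodularity and monotonicity, one more draw raises the
   expected value of g by at least a fraction 1/b of its gap to OPT, so that l
   draws give at least OPT * (1 - (1 - 1/b)^l). This is OPT/b for l = 1, and
   u <= exp (u - 1) for u = (1 - 1/b)^l gives the general bound. *)

(** * Sums over tuples and options *)

Lemma sum_tuple_cons (V : nmodType) (A : finType) n (F : n.+1.-tuple A -> V) :
  \sum_(t : n.+1.-tuple A) F t = \sum_a \sum_(t : n.-tuple A) F [tuple of a :: t].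
Proof.
rewrite pair_big /=.
rewrite (reindex (fun p : A * n.-tuple A => [tuple of p.1 :: p.2])) //=.
exists (fun t : n.+1.-tuple A => (thead t, [tuple of behead t])) => /=.
  by move=> [a t] _ /=; congr pair; apply: val_inj.
by move=> t _; rewrite [RHS]tuple_eta.
Qed.

Lemma sum_tuple0 (V : nmodType) (A : finType) (F : 0.-tuple A -> V) :
  \sum_(t : 0.-tuple A) F t = F [tuple].
Proof.
rewrite (eq_bigr (fun=> F [tuple])) => [|t _]; last by rewrite tuple0.
by rewrite sumr_const card_tuple expn0 mulr1n.
Qed.

Lemma sum_option (V : nmodType) (A : finType) (F : option A -> V) :
  \sum_o F o = F None + \sum_a F (Some a).
Proof.
rewrite (bigD1 None) //=; congr (_ + _).
rewrite (reindex_omap Some id) => [|[]//] /=.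
by apply: eq_bigl => a; rewrite eqxx.
Qed.

(** * The sequence of arriving balls *)

Definition arrivals (A : Type) b (s : seq (option A)) : seq A :=
  take b (pmap id s).

Section Arrivals.
Variables (A : eqType) (b : nat).
Implicit Type s : seq (option A).

(** The right-hand side is the stopping rule of [active] read on a word. The induction is for all
    capacities at once, because an arrival in the first round leaves one unit less for the rest. *)
Lemma mem_arrivals s (j : A) :
  (j \in arrivals b s) =
  [exists i : 'I_(size s),
     (count isSome (take i s) < b)%N && (nth None s i == Some j)].
Proof.
rewrite /arrivals; elim: s b => [|o s IHs] k.
  by rewrite /= in_nil; apply/esym/existsP => -[[]].
have shift m : [exists i : 'I_(size s).+1,
     (count isSome (take i (o :: s)) < m)%N && (nth None (o :: s) i == Some j)]
   = ((0 < m)%N && (o == Some j)) ||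
     [exists i : 'I_(size s),
     (o + count isSome (take i s) < m)%N && (nth None s i == Some j)].
  apply/existsP/orP => [[i]|[H|/existsP [i H]]].
  - case: (unliftP ord0 i) => [i'|] -> /= H; last by left.
    by right; apply/existsP; exists i'.
  - by exists ord0.
  by exists (lift ord0 i).
rewrite /= shift; case: o {shift} => [a|] /=; last first.
  by rewrite andbF IHs.
case: k => [|k] /=; first by rewrite in_nil; apply/esym/existsP => -[].
by rewrite in_cons IHs (inj_eq Some_inj) eq_sym.
Qed.

Lemma size_arrivals s :
  size (arrivals b s) =
  #|[set i : 'I_(size s) |
      (count isSome (take i s) < b)%N && (nth None s i != None)]|.
Proof.
rewrite -sum1_card big_mkcond /=.
under eq_bigr => i _ do rewrite inE.
rewrite /arrivals; elim: s b => [|o s IHs] k; first by rewrite big_ord0.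
rewrite /= big_ord_recl /=; case: o => [a|] /=; last first.
  by rewrite andbF add0n IHs.
case: k => [|k] /=; first by rewrite big1.
by rewrite IHs.
Qed.

End Arrivals.

Section Outcomes.
Variables (N : finType) (b T : nat).
Implicit Type t : T.-tuple (option N).

(** Tuples replace finite functions so that an induction on [T] can split off the first round. *)
Definition outcome_of t : outcome N T := [ffun i => tnth t i].

Lemma outcome_of_bij : bijective outcome_of.
Proof.
exists (fun w : outcome N T => [tuple w i | i < T]) => [t|w].
  by apply: eq_from_tnth => i; rewrite tnth_mktuple ffunE.
by apply/ffunP => i; rewrite ffunE tnth_mktuple.
Qed.

Lemma active_outcome_of t (i : 'I_T) :
  active b (outcome_of t) i = (count isSome (take i t) < b)%N.
Proof.
rewrite /active; congr (_ < b)%N.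
rewrite -sum1_card -size_filter -sum1_size big_filter.
rewrite (eq_bigl (fun s : 'I_T => isSome (nth None t s) && (s < i)%N)); last first.
  by move=> s; rewrite inE ffunE (tnth_nth None) andbC; case: (nth _ _ _).
rewrite (big_nth None) size_takel ?size_tuple 1?ltnW //.
rewrite -(big_ord_widen_cond T (fun s => isSome (nth None t s)) (fun=> 1%N)) 1?ltnW //.
by rewrite big_mkord; apply: eq_bigl => s; rewrite nth_take.
Qed.

Lemma arrived_outcome_of t :
  arrived b (outcome_of t) = [set j in arrivals b t].
Proof.
apply/setP => j; rewrite !inE mem_arrivals size_tuple.
by apply: eq_existsb => i; rewrite active_outcome_of ffunE (tnth_nth None).
Qed.

Lemma num_arrivals_outcome_of t :
  num_arrivals b (outcome_of t) = size (arrivals b t).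
Proof.
rewrite size_arrivals size_tuple; apply: eq_card => i.
by rewrite !inE active_outcome_of ffunE (tnth_nth None).
Qed.

End Outcomes.

(** * Independent draws and the law of the arrivals *)

Section Draws.
Variables (R : comNzRingType) (N : finType) (q : N -> R).

(** When [q] is a probability vector, this is the expectation of [h] on [l] independent draws. *)
Definition draws l (h : seq N -> R) : R :=
  \sum_(z : l.-tuple N) (\prod_(j <- z) q j) * h z.

Lemma drawsS l h : draws l.+1 h = \sum_j q j * draws l (fun z => h (j :: z)).
Proof.
rewrite /draws sum_tuple_cons; apply: eq_bigr => j _; rewrite mulr_sumr.
by apply: eq_bigr => z _; rewrite big_cons mulrA.
Qed.

Lemma draws_cst l a : \sum_j q j = 1 -> draws l (fun=> a) = a.
Proof.
move=> q1; elim: l => [|l IHl]; first by rewrite /draws sum_tuple0 big_nil mul1r.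
by rewrite drawsS -[RHS]mul1r -q1 mulr_suml; apply: eq_bigr => j _; rewrite IHl.
Qed.

(* The factor C does not depend on h: once the number of arrivals is fixed,
   the arriving balls are distributed as independent draws from q. *)
Lemma sum_arrivals (c : R) (r : option N -> R) (k T l : nat) :
  (forall j, r (Some j) = c * q j) ->
  exists C : R, forall h : seq N -> R,
    \sum_(t : T.-tuple (option N) | size (arrivals k t) == l)
       (\prod_(o <- t) r o) * h (arrivals k t) = C * draws l h.
Proof.
move=> rq; elim: T k l => [|T IHT] k l.
  exists (l == 0%N)%:R => h; rewrite big_mkcond sum_tuple0 /arrivals /= big_nil mul1r.
  by case: l => [|l] /=; rewrite /draws ?sum_tuple0 ?big_nil ?mul1r ?mul0r.
(* Condition on the first round: [C0] serves when it is empty, [C1] when a ball uses up one unit of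
   capacity and is the first of the [l] draws. *)
have [C0 C0E] := IHT k l; have [C1 C1E] := IHT k.-1 l.-1.
case: k => [|k] in C0 C0E C1 C1E *.
  have nil0 (s : seq (option N)) : arrivals 0 s = [::] by rewrite /arrivals take0.
  (* With no capacity left, every word yields the empty sequence. *)
  exists ((l == 0%N)%:R * \sum_(t : T.+1.-tuple (option N)) \prod_(o <- t) r o) => h.
  case: l {C0 C0E C1 C1E} => [|l].
    rewrite mul1r /draws sum_tuple0 big_nil mul1r mulr_suml.
    by apply: eq_big => t; rewrite nil0.
  by rewrite !mul0r big_pred0 // => t; rewrite nil0.
(* The indicator of [0 < l] removes the second term at [l = 0], where [l.-1] is again 0. *)
exists (r None * C0 + (0 < l)%N%:R * c * C1) => h.
rewrite big_mkcond sum_tuple_cons sum_option mulrDl; congr (_ + _).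
  rewrite -mulrA -C0E mulr_sumr [RHS]big_mkcond; apply: eq_bigr => t _ /=.
  by rewrite big_cons mulrA.
case: l {C0 C0E} => [|l] in C1 C1E *.
  by rewrite !mul0r big1 // => j _; rewrite big1.
rewrite mul1r drawsS mulr_sumr; apply: eq_bigr => j _.
rewrite mulrACA -rq -C1E mulr_sumr [RHS]big_mkcond.
by apply: eq_bigr => t _ /=; rewrite eqSS big_cons mulrA.
Qed.

End Draws.

Lemma cond_expect_process (R : realType) (N : finType) (b T l : nat)
    (y : N -> R) (h : {set N} -> R) :
  let P := @process_law R N b T y in
  let E : pred (outcome N T) := fun w => num_arrivals b w == l in
  (0 < b)%N -> (b <= T)%N -> \sum_j y j = b%:R -> 0 < prob P E ->
  cond_expect P (fun w => h (arrived b w)) E =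
    draws (fun j => y j / b%:R) l (fun z => h [set j in z]).
Proof.
move=> P E b_gt0 T_ge_b y_sum PE_gt0.
have b_neq0 : b%:R != 0 :> R by rewrite pnatr_eq0 -lt0n.
(* A round has an arrival with probability b/T, and the ball is then [j] with probability y_j/b. *)
have [j|C CE] := @sum_arrivals R N (fun j => y j / b%:R) (b%:R / T%:R)
  (round_law b T y) b T l.
  by rewrite /= [RHS]mulrC mulrA divfK.
have sumE X : \sum_(w | E w) P w * X (arrived b w) =
    C * draws (fun j => y j / b%:R) l (fun z => X [set j in z]).
  rewrite -CE (reindex (@outcome_of N T)); last first.
    by apply: onW_bij; apply: outcome_of_bij.
  apply: eq_big => t; first by rewrite /E num_arrivals_outcome_of.
  move=> _; rewrite arrived_outcome_of; congr (_ * _).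
  by rewrite /P /process_law big_tuple; apply: eq_bigr => i _; rewrite ffunE.
(* The constant function 1 identifies [C], which then cancels in the conditional expectation. *)
have PE : prob P E = C.
  transitivity (\sum_(w | E w) P w * 1); first by apply: eq_bigr => w _; rewrite mulr1.
  rewrite (sumE (fun=> 1)) draws_cst ?mulr1 //.
  by rewrite -mulr_suml y_sum mulfV.
by rewrite /cond_expect sumE PE mulrC mulKf // -PE gt_eqF.
Qed.

(** * Expected growth of [g] under one more draw *)

Section Greedy.
Variables (R : realType) (N : finType) (b : nat) (g x : {set N} -> R).
Hypotheses (b_gt0 : (0 < b)%N) (g_ge0 : forall S : {set N}, 0 <= g S)
  (g_mono : monotone_set_fun g) (g_submod : submodular g)
  (x_ge0 : forall S : {set N}, (#|S| <= b)%N -> 0 <= x S)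
  (x_sum : \sum_(S : {set N} | (#|S| <= b)%N) x S <= 1)
  (y_sum : \sum_(j : N) marginal b x j = b%:R).

(** Add the elements of [S] one at a time: by submodularity each gains at most what it would gain
    when added to [A] alone. *)
Lemma submodular_gain (A S : {set N}) :
  g (A :|: S) - g A <= \sum_(j in S) (g (j |: A) - g A).
Proof.
rewrite -[S in X in X <= _]set_enum -big_enum /=.
elim: (enum S) => [|j s IHs]; first by rewrite set_nil setU0 subrr big_nil.
rewrite set_cons big_cons.
have := g_submod (j |: A) (A :|: [set:: s]).
have -> : (j |: A) :|: (A :|: [set:: s]) = A :|: (j |: [set:: s]).
  by apply/setP => i; rewrite !inE; case: (i == j); case: (i \in A).
(* The intersection may exceed [A] when [j] occurs in [s]; monotonicity covers this case too. *)
have := g_mono (A := A) (B := (j |: A) :&: (A :|: [set:: s])).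
rewrite subsetI subsetUl subsetUr => /(_ isT).
lra.
Qed.

(** Exchanging sums turns the right-hand side into an [x]-weighted sum, over sets S, of the gains of
    the elements of S. Each inner sum is at least g(S) - g(A), and the total weight of g(A) is at
    most 1. *)
Lemma marginal_gain (A : {set N}) :
  opt b g x - g A <= \sum_j marginal b x j * (g (j |: A) - g A).
Proof.
under eq_bigr => j _ do rewrite /marginal mulr_suml big_mkcondr.
rewrite exchange_big /=.
apply: (@le_trans _ _ (\sum_(S : {set N} | (#|S| <= b)%N) x S * (g S - g A))).
  under eq_bigr => S _ do rewrite mulrBr.
  rewrite sumrB -mulr_suml /opt.
  under eq_bigr => S _ do rewrite mulrC.
  by rewrite lerB // ler_piMl.
apply: ler_sum => S Sb; rewrite -big_mkcond -mulr_sumr ler_wpM2l ?x_ge0 //.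
apply: le_trans (submodular_gain A S); rewrite lerB // g_mono //.
exact: subsetUr.
Qed.

Lemma draws_ge l :
  opt b g x * (1 - (1 - 1 / b%:R) ^+ l) <=
  draws (fun j => marginal b x j / b%:R) l (fun z => g [set j in z]).
Proof.
set q := fun j => _.
have := marginal_gain; move: (opt b g x) => M gain.
have b_gt0R : 0 < b%:R :> R by rewrite ltr0n.
have q_sum : \sum_j q j = 1 by rewrite -mulr_suml y_sum mulfV // gt_eqF.
have y_ge0 j : 0 <= marginal b x j.
  by apply: sumr_ge0 => S /andP[Sb _]; apply: x_ge0.
have q_ge0 j : 0 <= q j by rewrite divr_ge0 // ltW.
elim: l => [|l IHl].
  rewrite expr0 subrr mulr0 /draws sumr_ge0 // => z _.
  by rewrite mulr_ge0 // prodr_ge0.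
have step : (1 - 1 / b%:R) * draws q l (fun z => g [set j in z])
    + M / b%:R <= draws q l.+1 (fun z => g [set j in z]).
  (* Writing M/b as draws of a constant lets both sides be compared for each fixed [z]. The extra
     ball [j] may stand in front, since [g] sees only the set of balls. *)
  rewrite drawsS -[X in _ + X](draws_cst l _ q_sum) /draws mulr_sumr.
  under [leRHS]eq_bigr => j _ do rewrite mulr_sumr.
  rewrite exchange_big -big_split /=; apply: ler_sum => z _.
  under [leRHS]eq_bigr => j _ do rewrite mulrCA set_cons.
  rewrite mulrCA -mulrDr -mulr_sumr ler_wpM2l ?prodr_ge0 //.
  have : (M - g [set j in z]) / b%:R <=
      \sum_j q j * (g (j |: [set j in z]) - g [set j in z]).
    under eq_bigr => j _ do rewrite mulrAC.
    by rewrite -mulr_suml ler_pM2r ?invr_gt0 ?gain.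
  under eq_bigr => j _ do rewrite mulrBr.
  rewrite sumrB -mulr_suml q_sum; lra.
apply: le_trans step; rewrite exprS.
have : 0 <= 1 - 1 / b%:R :> R by rewrite subr_ge0 div1r invf_le1 // ler1n.
move/ler_wpM2l => /(_ _ _ IHl); lra.
Qed.

End Greedy.

Theorem theorem5 (R : realType) (N : finType) (b T : nat)
    (g x : {set N} -> R)
    (b_gt0 : (0 < b)%N)
    (g_ge0 : forall S : {set N}, 0 <= g S)
    (g_mono : monotone_set_fun g)
    (g_submod : submodular g)
    (g_set0 : g set0 = 0)
    (x_ge0 : forall S : {set N}, (#|S| <= b)%N -> 0 <= x S)
    (x_sum : \sum_(S : {set N} | (#|S| <= b)%N) x S <= 1)
    (y_sum : \sum_(j : N) marginal b x j = b%:R)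
    (T_ge_b : (b <= T)%N) :
  let P : outcome N T -> R := process_law b (marginal b x) in
  let A : outcome N T -> nat := fun w => num_arrivals b w in
  let gS : outcome N T -> R := fun w => g (arrived b w) in
  (0 < prob P (fun w => A w == 1%N) ->
     cond_expect P gS (fun w => A w == 1%N) >= opt b g x / b%:R)
  /\
  (forall l : nat, (2 <= l <= b)%N ->
     0 < prob P (fun w => A w == l) ->
     cond_expect P gS (fun w => A w == l) >=
       opt b g x * (1 - expR (- 1 + (1 - 1 / b%:R) ^+ l))).
Proof.
move=> P A gS.
have opt_ge0 : 0 <= opt b g x.
  by apply: sumr_ge0 => S Sb; rewrite mulr_ge0 // x_ge0.
have bound l : 0 < prob P (fun w => A w == l) ->
    opt b g x * (1 - (1 - 1 / b%:R) ^+ l) <= cond_expect P gS (fun w => A w == l).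
  move=> PA_gt0; rewrite (cond_expect_process (l := l) g b_gt0 T_ge_b y_sum) //.
  exact: draws_ge.
split=> [/bound|l _ /bound]; first by rewrite expr1 subKr mulrA mulr1.
apply: le_trans; rewrite ler_wpM2l // lerB //.
set u := _ ^+ _; apply: le_trans (expR_ge1Dx _); lra.
Qed.
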